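(* Let $\mathbb{X}$ be a cartesian linearly distributive category (CLDC), with initial object $\bot$ and terminal object $\top$. Then $\bot$ is subterminal and $\top$ is preinitial.
   Context: An object $A$ of a category is preinitial if for every object $X$ there is at most one map $A\to X$, and subterminal if for every object $X$ there is at most one map $X\to A$. Composition is written in diagrammatic order: $f;g$ means first $f$, then $g$. For finite products write $\times$, terminal object $\top$, projections $\pi^0,\pi^1$, pairing $\langle -,-\rangle$, $t_A:A\to\top$; for finite coproducts write $+$, initial object $\bot$, injections $\iota^0,\iota^1$, copairing $[-,-]$, $b_A:\bot\to A$. The canonical structure isomorphisms are $\alpha^\times_{A,B,C}:(A\times B)\times C\to A\times(B\times C)$, $r^\times_A:A\to A\times\top$, $l^\times_A:A\to\top\times A$, $\sigma^\times_{A,B}:A\times B\to B\times A$, and $\alpha^+_{A,B,C}:A+(B+C)\to(A+B)+C$, $r^+_A:A+\bot\to A$, $l^+_A:\bot+A\to A$, $\sigma^+_{A,B}:A+B\to B+A$. A cartesian linearly distributive category (CLDC) is a category with finite products and finite coproducts (a symmetric linearly distributive category whose tensor is the product and whose par is the coproduct), equipped with natural transformations (linear distributors) $\delta^R_{A,B,C}:(A+B)\times C\to A+(B\times C)$ and $\delta^L_{A,B,C}:A\times(B+C)\to(A\times B)+C$ such that for all objects: (1) $l^\times_{A+B};\delta^L_{\top,A,B}=l^\times_A+1_B$; $r^\times_{A+B};\delta^R_{A,B,\top}=1_A+r^\times_B$; $\delta^R_{\bot,A,B};l^+_{A\times B}=l^+_A\times 1_B$; $\delta^L_{A,B,\bot};r^+_{A\times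 B}=1_A\times r^+_B$. (2) $\delta^L_{A\times B,C,D};(\alpha^\times_{A,B,C}+1_D)=\alpha^\times_{A,B,C+D};(1_A\times\delta^L_{B,C,D});\delta^L_{A,B\times C,D}$; $(\alpha^+_{A,B,C}\times 1_D);\delta^R_{A+B,C,D}=\delta^R_{A,B+C,D};(1_A+\delta^R_{B,C,D});\alpha^+_{A,B,C\times D}$; $\delta^L_{A,B,C+D};\alpha^+_{A\times B,C,D}=(1_A\times\alpha^+_{B,C,D});\delta^L_{A,B+C,D};(\delta^L_{A,B,C}+1_D)$; $\alpha^\times_{A+B,C,D};\delta^R_{A,B,C\times D}=(\delta^R_{A,B,C}\times 1_D);\delta^R_{A,B\times C,D};(1_A+\alpha^\times_{B,C,D})$. (3) $\delta^L_{A+B,C,D};(\delta^R_{A,B,C}+1_D)=\delta^R_{A,B,C+D};(1_A+\delta^L_{B,C,D});\alpha^+_{A,B\times C,D}$; $(\delta^L_{A,B,C}\times 1_D);\delta^R_{A\times B,C,D}=\alpha^\times_{A,B+C,D};(1_A\times\delta^R_{B,C,D});\delta^L_{A,B,C\times D}$. (4) $\delta^R_{A,B,C}=\sigma^\times_{A+B,C};(1_C\times\sigma^+_{A,B});\delta^L_{C,B,A};(\sigma^\times_{C,B}+1_A);\sigma^+_{B\times C,A}$. *)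

(* Defs.v *)
From mathcomp Require Import ssreflect.

Set Implicit Arguments.
Unset Strict Implicit.
Unset Printing Implicit Defensive.

Declare Scope cat_scope.
Delimit Scope cat_scope with cat.
Local Open Scope cat_scope.

Reserved Notation "f ;; g" (at level 50, left associativity).
Reserved Notation "A × B" (at level 40, left associativity).
Reserved Notation "A ⨿ B" (at level 45, left associativity).
Reserved Notation "f ×m g" (at level 40, left associativity).
Reserved Notation "f ⨿m g" (at level 45, left associativity).

(* [comp f g] is in diagrammatic order: first [f], then [g]. *)
Record category := Category {
  obj :> Type;
  hom : obj -> obj -> Type;
  idm : forall A, hom A A;
  comp : forall A B C, hom A B -> hom B C -> hom A C;
  comp1m : forall A B (f : hom A B), comp (idm A) f = f;
  compm1 : forall A B (f : hom A B), comp f (idm B) = f;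
  compA : forall A B C D (f : hom A B) (g : hom B C) (h : hom C D),
    comp (comp f g) h = comp f (comp g h)
}.
Arguments hom {c} A B.
Arguments idm {c} A.
Arguments comp {c A B C} f g.

Notation "f ;; g" := (comp f g) : cat_scope.

Definition preinitial (C : category) (A : C) : Prop :=
  forall (X : C) (f g : hom A X), f = g.

Definition subterminal (C : category) (A : C) : Prop :=
  forall (X : C) (f g : hom X A), f = g.

Record finite_products (C : category) := FiniteProducts {
  top : C;
  tmap : forall A, hom A top;
  tmap_uniq : forall A (f : hom A top), f = tmap A;
  prd : C -> C -> C;
  pi0 : forall A B, hom (prd A B) A;
  pi1 : forall A B, hom (prd A B) B;
  pairing : forall X A B, hom X A -> hom X B -> hom X (prd A B);
  pairing_pi0 : forall X A B (f : hom X A) (g : hom X B),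
    pairing f g ;; pi0 A B = f;
  pairing_pi1 : forall X A B (f : hom X A) (g : hom X B),
    pairing f g ;; pi1 A B = g;
  pairing_uniq : forall X A B (f : hom X A) (g : hom X B) (h : hom X (prd A B)),
    h ;; pi0 A B = f -> h ;; pi1 A B = g -> h = pairing f g
}.

Record finite_coproducts (C : category) := FiniteCoproducts {
  bot : C;
  bmap : forall A, hom bot A;
  bmap_uniq : forall A (f : hom bot A), f = bmap A;
  cop : C -> C -> C;
  in0 : forall A B, hom A (cop A B);
  in1 : forall A B, hom B (cop A B);
  copairing : forall A B X, hom A X -> hom B X -> hom (cop A B) X;
  in0_copairing : forall A B X (f : hom A X) (g : hom B X),
    in0 A B ;; copairing f g = f;
  in1_copairing : forall A B X (f : hom A X) (g : hom B X),
    in1 A B ;; copairing f g = g;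
  copairing_uniq : forall A B X (f : hom A X) (g : hom B X) (h : hom (cop A B) X),
    in0 A B ;; h = f -> in1 A B ;; h = g -> h = copairing f g
}.

Record bicartesian := Bicartesian {
  bicat :> category;
  bicat_prod : finite_products bicat;
  bicat_coprod : finite_coproducts bicat
}.

Definition Top (X : bicartesian) : X := top (bicat_prod X).
Definition Bot (X : bicartesian) : X := bot (bicat_coprod X).

Notation "A × B" := (prd (bicat_prod _) A B) : cat_scope.
Notation "A ⨿ B" := (cop (bicat_coprod _) A B) : cat_scope.
Notation π0 := (pi0 (bicat_prod _) _ _).
Notation π1 := (pi1 (bicat_prod _) _ _).
Notation ι0 := (in0 (bicat_coprod _) _ _).
Notation ι1 := (in1 (bicat_coprod _) _ _).
Notation "⟨ f , g ⟩" := (pairing (bicat_prod _) f g) (at level 0) : cat_scope.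
Notation "⦅ f , g ⦆" := (copairing (bicat_coprod _) f g) (at level 0) : cat_scope.

Definition prdm (X : bicartesian) (A B A' B' : X)
  (f : hom A A') (g : hom B B') : hom (A × B) (A' × B') := ⟨ π0 ;; f, π1 ;; g ⟩.
Definition copm (X : bicartesian) (A B A' B' : X)
  (f : hom A A') (g : hom B B') : hom (A ⨿ B) (A' ⨿ B') := ⦅ f ;; ι0, g ;; ι1 ⦆.

Notation "f ×m g" := (prdm f g) : cat_scope.
Notation "f ⨿m g" := (copm f g) : cat_scope.

Definition aprd (X : bicartesian) (A B C : X) : hom ((A × B) × C) (A × (B × C)) :=
  ⟨ π0 ;; π0, ⟨ π0 ;; π1, π1 ⟩ ⟩.
Definition rprd (X : bicartesian) (A : X) : hom A (A × Top X) :=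
  ⟨ idm A, tmap (bicat_prod X) A ⟩.
Definition lprd (X : bicartesian) (A : X) : hom A (Top X × A) :=
  ⟨ tmap (bicat_prod X) A, idm A ⟩.
Definition sprd (X : bicartesian) (A B : X) : hom (A × B) (B × A) := ⟨ π1, π0 ⟩.

Definition acop (X : bicartesian) (A B C : X) : hom (A ⨿ (B ⨿ C)) ((A ⨿ B) ⨿ C) :=
  ⦅ ι0 ;; ι0, ⦅ ι1 ;; ι0, ι1 ⦆ ⦆.
Definition rcop (X : bicartesian) (A : X) : hom (A ⨿ Bot X) A :=
  ⦅ idm A, bmap (bicat_coprod X) A ⦆.
Definition lcop (X : bicartesian) (A : X) : hom (Bot X ⨿ A) A :=
  ⦅ bmap (bicat_coprod X) A, idm A ⦆.
Definition scop (X : bicartesian) (A B : X) : hom (A ⨿ B) (B ⨿ A) := ⦅ ι1, ι0 ⦆.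


Record cldc := CLDC {
  cldc_base :> bicartesian;
  δR : forall A B C : cldc_base, hom ((A ⨿ B) × C) (A ⨿ (B × C));
  δL : forall A B C : cldc_base, hom (A × (B ⨿ C)) ((A × B) ⨿ C);
  δR_natural : forall (A B C A' B' C' : cldc_base)
      (f : hom A A') (g : hom B B') (h : hom C C'),
    ((f ⨿m g) ×m h) ;; δR A' B' C' = δR A B C ;; (f ⨿m (g ×m h));
  δL_natural : forall (A B C A' B' C' : cldc_base)
      (f : hom A A') (g : hom B B') (h : hom C C'),
    (f ×m (g ⨿m h)) ;; δL A' B' C' = δL A B C ;; ((f ×m g) ⨿m h);
  δL_lprd : forall A B : cldc_base,
    lprd (A ⨿ B) ;; δL (Top cldc_base) A B = lprd A ⨿m idm B;
  δR_rprd : forall A B : cldc_base,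
    rprd (A ⨿ B) ;; δR A B (Top cldc_base) = idm A ⨿m rprd B;
  δR_lcop : forall A B : cldc_base,
    δR (Bot cldc_base) A B ;; lcop (A × B) = lcop A ×m idm B;
  δL_rcop : forall A B : cldc_base,
    δL A B (Bot cldc_base) ;; rcop (A × B) = idm A ×m rcop B;
  δL_aprd : forall A B C D : cldc_base,
    δL (A × B) C D ;; (aprd A B C ⨿m idm D)
    = aprd A B (C ⨿ D) ;; (idm A ×m δL B C D) ;; δL A (B × C) D;
  δR_acop : forall A B C D : cldc_base,
    (acop A B C ×m idm D) ;; δR (A ⨿ B) C D
    = δR A (B ⨿ C) D ;; (idm A ⨿m δR B C D) ;; acop A B (C × D);
  δL_acop : forall A B C D : cldc_base,
    δL A B (C ⨿ D) ;; acop (A × B) C D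
    = (idm A ×m acop B C D) ;; δL A (B ⨿ C) D ;; (δL A B C ⨿m idm D);
  δR_aprd : forall A B C D : cldc_base,
    aprd (A ⨿ B) C D ;; δR A B (C × D)
    = (δR A B C ×m idm D) ;; δR A (B × C) D ;; (idm A ⨿m aprd B C D);
  δLR_acop : forall A B C D : cldc_base,
    δL (A ⨿ B) C D ;; (δR A B C ⨿m idm D)
    = δR A B (C ⨿ D) ;; (idm A ⨿m δL B C D) ;; acop A (B × C) D;
  δLR_aprd : forall A B C D : cldc_base,
    (δL A B C ×m idm D) ;; δR (A × B) C D
    = aprd A (B ⨿ C) D ;; (idm A ×m δR B C D) ;; δL A B (C × D);
  δR_sym : forall A B C : cldc_base,
    δR A B C
    = sprd (A ⨿ B) C ;; (idm C ×m scop A B) ;; δL C B A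
      ;; (sprd C B ⨿m idm A) ;; scop (B × C) A
}.

(* Main.v *)
From mathcomp Require Import ssreflect.
Require Import Defs.

(** A linear distributor is trivial on points: the unit law and naturality
    force [δL], restricted along a point [a : ⊤ → A] of its first argument, to
    be the map that inserts [a] into the left summand of [B ⨿ C] and leaves
    the right summand alone ([graph_point_δL]); symmetrically for [δR]
    ([point_graph_δR]).  Now the mixed coherence [δLR_acop] equates two maps
    [(A ⨿ B) × (C ⨿ D) → (A ⨿ (B × C)) ⨿ D].  Evaluate both at the point
    [⟨ι0, ι1⟩] with [A = D = ⊤].  The composite starting with [δL] sees that
    its second coordinate lies in [D] and returns that coordinate; the one
    starting with [δR] sees that its first coordinate lies in [A] and returns
    that one.  Hence the two outer injections [⊤ → (⊤ ⨿ (B × C)) ⨿ ⊤]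
    coincide, and copairing any two points of an object against them shows
    that these points are equal: [⊤] is preinitial.

    The axioms are self-dual, the duality exchanging products with coproducts,
    [δL] with [δR], and [δLR_acop] with [δLR_aprd].  The dual argument
    identifies the two outer projections [(⊥ × (B ⨿ C)) × ⊥ → ⊥], so [⊥] is
    subterminal. *)

Set Implicit Arguments.
Unset Strict Implicit.
Unset Printing Implicit Defensive.

Local Open Scope cat_scope.

Section Bicartesian.

Variable X : bicartesian.
Implicit Types A B C D Y Z : X.

Lemma to_top_eq A (f g : hom A (Top X)) : f = g.
Proof. by rewrite (tmap_uniq f) (tmap_uniq g). Qed.

Lemma from_bot_eq A (f g : hom (Bot X) A) : f = g.
Proof. by rewrite (bmap_uniq f) (bmap_uniq g). Qed.

Lemma comp_pairing Y Z A B (h : hom Y Z) (f : hom Z A) (g : hom Z B) :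
  h ;; ⟨ f, g ⟩ = ⟨ h ;; f, h ;; g ⟩.
Proof. by apply: pairing_uniq; rewrite compA ?pairing_pi0 ?pairing_pi1. Qed.

Lemma copairing_comp A B Y Z (f : hom A Y) (g : hom B Y) (h : hom Y Z) :
  ⦅ f, g ⦆ ;; h = ⦅ f ;; h, g ;; h ⦆.
Proof.
by apply: copairing_uniq; rewrite -compA ?in0_copairing ?in1_copairing.
Qed.

Lemma pairing_prdm Y A B C D (f : hom Y A) (g : hom Y B)
    (h : hom A C) (k : hom B D) :
  ⟨ f, g ⟩ ;; (h ×m k) = ⟨ f ;; h, g ;; k ⟩.
Proof.
by rewrite /prdm comp_pairing -!compA pairing_pi0 pairing_pi1.
Qed.

Lemma copm_copairing Y A B C D (f : hom A Y) (g : hom B Y)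
    (h : hom C A) (k : hom D B) :
  (h ⨿m k) ;; ⦅ f, g ⦆ = ⦅ h ;; f, k ;; g ⦆.
Proof.
by rewrite /copm copairing_comp !compA in0_copairing in1_copairing.
Qed.

Lemma prdm_pi0 A B C D (h : hom A C) (k : hom B D) :
  (h ×m k) ;; π0 = π0 ;; h.
Proof. exact: pairing_pi0. Qed.

Lemma prdm_pi1 A B C D (h : hom A C) (k : hom B D) :
  (h ×m k) ;; π1 = π1 ;; k.
Proof. exact: pairing_pi1. Qed.

Lemma in0_copm A B C D (h : hom A C) (k : hom B D) :
  ι0 ;; (h ⨿m k) = h ;; ι0.
Proof. exact: in0_copairing. Qed.

Lemma in1_copm A B C D (h : hom A C) (k : hom B D) :
  ι1 ;; (h ⨿m k) = k ;; ι1.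
Proof. exact: in1_copairing. Qed.

Lemma prdm11 A B : idm A ×m idm B = idm (A × B).
Proof.
by rewrite /prdm !compm1; symmetry; apply: pairing_uniq; rewrite comp1m.
Qed.

Lemma copm11 A B : idm A ⨿m idm B = idm (A ⨿ B).
Proof.
by rewrite /copm !comp1m; symmetry; apply: copairing_uniq; rewrite compm1.
Qed.

Lemma copm_comp1 A B C D (f : hom A B) (g : hom B C) :
  (f ⨿m idm D) ;; (g ⨿m idm D) = (f ;; g) ⨿m idm D.
Proof. by rewrite {2}/copm copm_copairing /copm -!compA comp1m. Qed.

Lemma copm_1comp A B C D (f : hom A B) (g : hom B C) :
  (idm D ⨿m f) ;; (idm D ⨿m g) = idm D ⨿m (f ;; g).
Proof. by rewrite {2}/copm copm_copairing /copm -!compA comp1m. Qed.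

Lemma prdm_comp1 A B C D (f : hom A B) (g : hom B C) :
  (f ×m idm D) ;; (g ×m idm D) = (f ;; g) ×m idm D.
Proof. by rewrite {1}/prdm pairing_prdm /prdm !compA comp1m. Qed.

Lemma prdm_1comp A B C D (f : hom A B) (g : hom B C) :
  (idm D ×m f) ;; (idm D ×m g) = idm D ×m (f ;; g).
Proof. by rewrite {1}/prdm pairing_prdm /prdm !compA comp1m. Qed.

End Bicartesian.

Section Distributors.

Variable X : cldc.
Implicit Types A B C Y : X.

Notation "'!' A" := (tmap (bicat_prod X) A) (at level 0, A at level 0).
Notation "'¡' A" := (bmap (bicat_coprod X) A) (at level 0, A at level 0).

(** The map [⟨ ! ;; a, 1 ⟩] is the unitor [Y → ⊤ × Y] followed by [a × 1], so
    naturality in the first argument reduces this to the unit law [δL_lprd]. *)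
Lemma graph_point_δL A B C (a : hom (Top X) A) :
  ⟨ !(B ⨿ C) ;; a, idm (B ⨿ C) ⟩ ;; δL A B C
  = ⟨ !B ;; a, idm B ⟩ ⨿m idm C.
Proof.
have graphE Y : ⟨ !Y ;; a, idm Y ⟩ = lprd Y ;; (a ×m idm Y).
  by rewrite /lprd pairing_prdm comp1m.
rewrite !graphE -copm_comp1 -δL_lprd !compA -δL_natural.
by rewrite copm11.
Qed.

Lemma point_graph_δR A B C (c : hom (Top X) C) :
  ⟨ idm (A ⨿ B), !(A ⨿ B) ;; c ⟩ ;; δR A B C
  = idm A ⨿m ⟨ idm B, !B ;; c ⟩.
Proof.
have graphE Y : ⟨ idm Y, !Y ;; c ⟩ = rprd Y ;; (idm Y ×m c).
  by rewrite /rprd pairing_prdm comp1m.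
rewrite !graphE -copm_1comp -δR_rprd !compA -δR_natural.
by rewrite copm11.
Qed.

(** Dual of [graph_point_δL], obtained from the unit law [δR_lcop]. *)
Lemma δR_cograph_copoint A B C (a : hom A (Bot X)) :
  δR A B C ;; ⦅ a ;; ¡(B × C), idm (B × C) ⦆
  = ⦅ a ;; ¡B, idm B ⦆ ×m idm C.
Proof.
have cographE Y : ⦅ a ;; ¡Y, idm Y ⦆ = (a ⨿m idm Y) ;; lcop Y.
  by rewrite /lcop copm_copairing comp1m.
rewrite !cographE -prdm_comp1 -δR_lcop -!compA δR_natural.
by rewrite prdm11.
Qed.

(** Dual of [point_graph_δR], obtained from the unit law [δL_rcop]. *)
Lemma δL_copoint_cograph A B C (c : hom C (Bot X)) :
  δL A B C ;; ⦅ idm (A × B), c ;; ¡(A × B) ⦆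
  = idm A ×m ⦅ idm B, c ;; ¡B ⦆.
Proof.
have cographE Y : ⦅ idm Y, c ;; ¡Y ⦆ = (idm Y ⨿m c) ;; rcop Y.
  by rewrite /rcop copm_copairing comp1m.
rewrite !cographE -prdm_1comp -δL_rcop -!compA δL_natural.
by rewrite prdm11.
Qed.

(** Both sides are the value at the point [⟨ ι0, ι1 ⟩] of the map
    [(⊤ ⨿ B) × (C ⨿ ⊤) → (⊤ ⨿ (B × C)) ⨿ ⊤] given by [δLR_acop]. *)
Lemma outer_injections_eq B C :
  (ι0 ;; ι0 : hom (Top X) ((Top X ⨿ (B × C)) ⨿ Top X)) = ι1.
Proof.
set p : hom (Top X) (Top X ⨿ B) := ι0.
set q : hom (Top X) (C ⨿ Top X) := ι1.
have evalL : ⟨ p, q ⟩ ;; δL (Top X ⨿ B) C (Top X) = ι1.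
  (* As [⊤] has a single endomorphism, [⟨ p, q ⟩] is [q] followed by the graph
     of the constant map at [p]. *)
  have -> : ⟨ p, q ⟩ = q ;; ⟨ !(C ⨿ Top X) ;; p, idm _ ⟩.
    rewrite comp_pairing compm1 -compA.
    by rewrite (to_top_eq (q ;; !(C ⨿ Top X)) (idm _)) comp1m.
  by rewrite compA graph_point_δL in1_copm comp1m.
have evalR : ⟨ p, q ⟩ ;; δR (Top X) B (C ⨿ Top X) = ι0.
  have -> : ⟨ p, q ⟩ = p ;; ⟨ idm _, !(Top X ⨿ B) ;; q ⟩.
    rewrite comp_pairing compm1 -compA.
    by rewrite (to_top_eq (p ;; !(Top X ⨿ B)) (idm _)) comp1m.
  by rewrite compA point_graph_δR in0_copm comp1m.
have := f_equal (comp ⟨ p, q ⟩) (δLR_acop (Top X) B C (Top X)).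
rewrite -!compA evalL evalR in1_copm in0_copm !comp1m => ->.
by rewrite /acop in0_copairing.
Qed.

(** Dual of [outer_injections_eq]: both sides are the composite of the map
    [(⊥ × (B ⨿ C)) × ⊥ → (⊥ × B) ⨿ (C × ⊥)] given by [δLR_aprd] with the
    copoint [⦅ π0, π1 ⦆]. *)
Lemma outer_projections_eq B C :
  (π0 ;; π0 : hom ((Bot X × (B ⨿ C)) × Bot X) (Bot X)) = π1.
Proof.
set p : hom (Bot X × B) (Bot X) := π0.
set q : hom (C × Bot X) (Bot X) := π1.
have evalR : δR (Bot X × B) C (Bot X) ;; ⦅ p, q ⦆ = π1.
  have -> : ⦅ p, q ⦆ = ⦅ p ;; ¡(C × Bot X), idm _ ⦆ ;; q.
    rewrite copairing_comp comp1m compA.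
    by rewrite (from_bot_eq (¡(C × Bot X) ;; q) (idm _)) compm1.
  by rewrite -compA δR_cograph_copoint prdm_pi1 compm1.
have evalL : δL (Bot X) B (C × Bot X) ;; ⦅ p, q ⦆ = π0.
  have -> : ⦅ p, q ⦆ = ⦅ idm _, q ;; ¡(Bot X × B) ⦆ ;; p.
    rewrite copairing_comp comp1m compA.
    by rewrite (from_bot_eq (¡(Bot X × B) ;; p) (idm _)) compm1.
  by rewrite -compA δL_copoint_cograph prdm_pi0 compm1.
have := f_equal (fun h => h ;; ⦅ p, q ⦆) (δLR_aprd (Bot X) B C (Bot X)).
rewrite /= !compA evalL evalR prdm_pi1 prdm_pi0 !compm1 => ->.
by rewrite /aprd pairing_pi0.
Qed.

Lemma top_preinitial : preinitial (Top X).
Proof.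
move=> Y f g.
pose h : hom ((Top X ⨿ (Top X × Top X)) ⨿ Top X) Y := ⦅ ⦅ f, π0 ;; f ⦆, g ⦆.
have := f_equal (fun k => k ;; h) (outer_injections_eq (Top X) (Top X)).
by rewrite /h compA !in0_copairing in1_copairing.
Qed.

Lemma bot_subterminal : subterminal (Bot X).
Proof.
move=> Y f g.
pose h : hom Y ((Bot X × (Bot X ⨿ Bot X)) × Bot X) := ⟨ ⟨ f, f ;; ι0 ⟩, g ⟩.
have := f_equal (comp h) (outer_projections_eq (Bot X) (Bot X)).
by rewrite /h -compA !pairing_pi0 pairing_pi1.
Qed.

End Distributors.

Theorem proposition3p5 (X : cldc) : subterminal (Bot X) /\ preinitial (Top X).
Proof. by split; [exact: bot_subterminal | exact: top_preinitial]. Qed.
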